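(* For every $n\in\mathbb{N}$, $n\ge 1$, the pair $(A,L)$ is a biautomatic structure for the sylvester monoid $S_n$ of rank $n$.
   Context: Let $A=\{1<2<\dots<n\}$ and let $\mathcal{R}=\{(cavb,acvb):a,b,c\in A,\ a\le b<c,\ v\in A^*\}$. The sylvester monoid of rank $n$, denoted $S_n$, is the monoid presented by $\langle A\mid\mathcal{R}\rangle$. Let $L=A^*-A^*\{cavb:a,b,c\in A,\ a\le b<c,\ v\in A^*\}A^*$, i.e. the set of words containing no left-hand side $cavb$ of a rule $cavb\to acvb$ from $\mathcal{R}$ as a (contiguous) subword. Biautomatic structures: let $\$$ be a symbol not in $A$. For $u=u_1\cdots u_m$ and $v=v_1\cdots v_p$ in $A^*$, $\delta_{\mathrm{R}}(u,v)$ is the word over the alphabet $(A\cup\{\$\})\times(A\cup\{\$\})$ obtained by padding the shorter of $u,v$ on the right with symbols $\$$ until the lengths agree and then pairing letters position by position; $\delta_{\mathrm{L}}(u,v)$ is defined in the same way but padding the shorter word on the left. For a relation $R\subseteq A^*\times A^*$, $R\delta_{\mathrm{R}}$ and $R\delta_{\mathrm{L}}$ denote the images of $R$. Let $M$ be a monoid, $A$ a finite alphabet representing a set of generators for $M$, and $L\subseteq A^*$ a regular language such that every element of $M$ has at least one representative in $L$. For $a\in A\cup\{\varepsilon\}$ ($\varepsilon$ the empty word) let $L_a=\{(u,v):u,v\in L,\ ua=_M v\}$ and ${}_aL=\{(u,v):u,v\in L,\ au=_M v\}$, where $=_M$ means representing the same element of $M$. The pair $(A,L)$ is a biautomatic structure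 for $M$ if $L_a\delta_{\mathrm{R}}$, ${}_aL\delta_{\mathrm{R}}$, $L_a\delta_{\mathrm{L}}$ and ${}_aL\delta_{\mathrm{L}}$ are regular languages over $(A\cup\{\$\})\times(A\cup\{\$\})$ for all $a\in A\cup\{\varepsilon\}$. *)

(* Defs.v *)
From HB Require Import structures.
From mathcomp Require Import all_boot.
From mathcomp Require Import boolp classical_sets.

Set Implicit Arguments.
Unset Strict Implicit.
Unset Printing Implicit Defensive.

Local Open Scope classical_set_scope.
Local Open Scope quotient_scope.

Definition language (A : Type) := set (seq A).

Definition cat_lang (A : Type) (K1 K2 : language A) : language A :=
  [set u ++ v | u in K1 & v in K2].

(* Recognised by a complete deterministic finite automaton. *)
Definition regular (A : Type) (K : language A) : Prop :=
  exists (Q : finType) (q0 : Q) (delta : Q -> A -> Q) (F : {pred Q}),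
    forall w : seq A, K w <-> foldl delta q0 w \in F.

(* [None] plays the role of the padding symbol $. *)
Definition deltaR (A : Type) (uv : seq A * seq A) :
    seq (option A * option A) :=
  let: (u, v) := uv in
  zip (map Some u ++ nseq (size v - size u) None)
      (map Some v ++ nseq (size u - size v) None).

Definition deltaL (A : Type) (uv : seq A * seq A) :
    seq (option A * option A) :=
  let: (u, v) := uv in
  zip (nseq (size v - size u) None ++ map Some u)
      (nseq (size u - size v) None ++ map Some v).

Inductive pres_congr (A : Type) (R : set (seq A * seq A)) :
    seq A -> seq A -> Prop :=
| PresRule l r : R (l, r) -> pres_congr R l r
| PresRefl u : pres_congr R u u
| PresSym u v : pres_congr R u v -> pres_congr R v u
| PresTrans u v w : pres_congr R u v -> pres_congr R v w -> pres_congr R u w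
| PresCat u u' v v' : pres_congr R u u' -> pres_congr R v v' ->
    pres_congr R (u ++ v) (u' ++ v').

Section PresentedMonoid.

Variables (A : choiceType) (R : set (seq A * seq A)).

Definition pres_rel : rel (seq A) := fun u v => `[< pres_congr R u v >].

Lemma pres_rel_refl : reflexive pres_rel.
Proof. by move=> u; apply/asboolP; apply: PresRefl. Qed.

Lemma pres_rel_sym : symmetric pres_rel.
Proof. by move=> u v; apply/asboolP/asboolP; apply: PresSym. Qed.

Lemma pres_rel_trans : transitive pres_rel.
Proof.
move=> v u w /asboolP uv /asboolP vw.
by apply/asboolP; apply: PresTrans uv vw.
Qed.

Canonical pres_equiv :=
  EquivRel pres_rel pres_rel_refl pres_rel_sym pres_rel_trans.

Definition presented_monoid : Type := {eq_quot pres_rel}.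

HB.instance Definition _ := Choice.on presented_monoid.
HB.instance Definition _ := EqQuotient.on presented_monoid.

Definition pres_class (u : seq A) : presented_monoid :=
  \pi_(presented_monoid) u.

Lemma pres_classP u v : pres_class u = pres_class v <-> pres_congr R u v.
Proof.
split; first by move/eqmodP/asboolP.
by move=> uv; apply/eqmodP/asboolP.
Qed.

Lemma pres_class_repr (x : presented_monoid) : pres_class (repr x) = x.
Proof. exact: reprK. Qed.

Lemma pres_repr_class u : pres_congr R (repr (pres_class u)) u.
Proof. by apply/pres_classP; rewrite pres_class_repr. Qed.

Definition pres_one : presented_monoid := pres_class [::].

Definition pres_mul (x y : presented_monoid) : presented_monoid :=
  pres_class (repr x ++ repr y).

Lemma pres_mul_class u v :
  pres_mul (pres_class u) (pres_class v) = pres_class (u ++ v).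
Proof. by apply/pres_classP; apply: PresCat; apply: pres_repr_class. Qed.

Lemma pres_mulA : associative pres_mul.
Proof.
move=> x y z; rewrite -(pres_class_repr x) -(pres_class_repr y).
by rewrite -(pres_class_repr z) !pres_mul_class catA.
Qed.

Lemma pres_mul1 : left_id pres_one pres_mul.
Proof. by move=> x; rewrite -(pres_class_repr x) pres_mul_class. Qed.

Lemma pres_mulr1 : right_id pres_one pres_mul.
Proof. by move=> x; rewrite -(pres_class_repr x) pres_mul_class cats0. Qed.

HB.instance Definition _ :=
  isMonoid.Build presented_monoid pres_mulA pres_mul1 pres_mulr1.

Definition pres_gen (a : A) : presented_monoid := pres_class [:: a].

End PresentedMonoid.

Section Biautomatic.

Variables (A : finType) (M : monoidType) (gen : A -> M) (L : language A).

Definition word_val (w : seq A) : M := (\big[*%g/1]_(a <- w) gen a)%g.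

(* Elements of A together with the empty word, [None] being the empty word. *)
Definition letter_word (a : option A) : seq A :=
  if a is Some x then [:: x] else [::].

(* L_a, and below it _aL. *)
Definition mulr_rel (a : option A) : set (seq A * seq A) :=
  [set uv | [/\ L uv.1, L uv.2 &
    word_val (uv.1 ++ letter_word a) = word_val uv.2]].

Definition mull_rel (a : option A) : set (seq A * seq A) :=
  [set uv | [/\ L uv.1, L uv.2 &
    word_val (letter_word a ++ uv.1) = word_val uv.2]].

(* The second clause also says that [gen] enumerates a generating set of M. *)
Definition biautomatic_structure : Prop :=
  [/\ regular L,
      forall m : M, exists2 w, L w & word_val w = m &
      forall a : option A,
        [/\ regular (@deltaR A @` mulr_rel a),
            regular (@deltaR A @` mull_rel a),
            regular (@deltaL A @` mulr_rel a) &
            regular (@deltaL A @` mull_rel a)]].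

End Biautomatic.

Lemma word_val_pres_gen (A : finType) (R : set (seq A * seq A)) (w : seq A) :
  word_val (@pres_gen A R) w = pres_class R w.
Proof.
rewrite /word_val; elim: w => [|a w IHw]; first by rewrite big_nil.
by rewrite big_cons IHw; apply: pres_mul_class.
Qed.

(* The alphabet 1 < ... < n is ['I_n] with its usual order. *)
Definition sylvester_rules (n : nat) : set (seq 'I_n * seq 'I_n) :=
  [set p | exists (a b c : 'I_n) (v : seq 'I_n), (a <= b < c)%N /\
    p = ([:: c; a] ++ v ++ [:: b], [:: a; c] ++ v ++ [:: b])].

Definition sylvester_monoid (n : nat) : monoidType :=
  presented_monoid (@sylvester_rules n).

Definition sylvester_gen (n : nat) : 'I_n -> sylvester_monoid n :=
  @pres_gen 'I_n (@sylvester_rules n).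

Definition sylvester_lhs (n : nat) : language 'I_n :=
  [set w | exists (a b c : 'I_n) (v : seq 'I_n), (a <= b < c)%N /\
    w = [:: c; a] ++ v ++ [:: b]].

Definition sylvester_lang (n : nat) : language 'I_n :=
  setT `\` cat_lang (cat_lang setT (@sylvester_lhs n)) setT.

(* Main.v *)
Require Import Defs.
From mathcomp Require Import all_boot.
From mathcomp Require Import boolp classical_sets.
From mathcomp Require Import zify.

Set Implicit Arguments.
Unset Strict Implicit.
Unset Printing Implicit Defensive.

Local Open Scope classical_set_scope.

(** Two congruent words insert into the same binary search tree: inserting a word
    letter by letter from the right, with equal letters going left, the letter [b]
    of a rule [c a v b -> a c v b] sits in the tree before [a] and [c] arrive,
    and a node with label in [[a, c)] sends them into different subtrees, so
    that their order is irrelevant ([congr_inserts]).  The words of the language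
    are the postorder readings of these trees ([postorder_inserts]), hence
    normal forms ([congr_avoids_eq]).

    Forbidding the factors [c a v b] forbids the scattered subwords [c a b] with
    [a <= b < c] altogether: between [c] and [a] some letter greater than [b] is
    followed immediately by one that is at most [b].  The language is thus
    closed under taking subwords, and after a letter [c] the letters smaller
    than [c] decrease strictly ([sylvester_langE]).

    For normal forms both multiplications are explicit.  The root of the tree of
    [u a] is [a], and its subtrees come from the letters [<= a] and [> a] of
    [u]; the normal form of [u a] is therefore [u1 u2 a], where [u1] and [u2]
    are the subwords of [u] formed by these letters ([congr_rconsE]).  On the
    left, [a] enters the tree of [u] as a new leaf: in the normal form [v] of
    [a u] it is the first [a], it can be pulled to the front of [v] by reversed
    rules, and deleting it leaves [u] ([congr_consE]).

    These relations are regular because their two sides are compared with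
    bounded delay.  On the left, after the first [a] of [v], the word [u] runs
    exactly one letter ahead ([regular_removal]).  On the right, once a letter
    greater than [a] has been read in [u], the remaining letters [<= a] of [u]
    decrease strictly, so there are at most [n] of them; each half of [u1 u2]
    is then at most [n] letters ahead of or behind the same half of what has
    been read of [u] ([split_pairs_lag]).  Since the two words differ in length by
    exactly one, padding on the left instead of on the right only shifts one of
    them by one position ([regular_deltaL]). *)

(** * Sequences *)

Lemma subseq_filterS (T : eqType) (p q : pred T) (s t : seq T) :
  subpred p q -> subseq s t -> subseq (filter p s) (filter q t).
Proof.
move=> pq st; rewrite subseq_filter (subseq_trans (filter_subseq _ _) st) andbT.
by apply/allP => x; rewrite mem_filter => /andP[/pq].
Qed.

Lemma cat_eq_prefix (T : Type) (p q r s : seq T) :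
  size p <= size r -> p ++ q = r ++ s ->
  exists2 m, r = p ++ m & q = m ++ s.
Proof.
elim: p r => [|x p IHp] [|y r] //=; first by move=> _ ->; exists [::].
  by move=> _ ->; exists (y :: r).
by move=> pr [-> /(IHp _ pr)[m -> ->]]; exists m.
Qed.

Lemma rem_map_inj (A B : eqType) (h : A -> B) x s : injective h ->
  rem (h x) (map h s) = map h (rem x s).
Proof.
move=> h_inj; elim: s => //= y s IHs; rewrite (inj_eq h_inj).
by case: eqP => //= _; rewrite IHs.
Qed.

(** * Regular languages *)

Section Regular.
Context {A : finType}.
Implicit Types (K : language A) (u v w s : seq A).

(** A form of the Myhill-Nerode theorem: finitely many classes of prefixes, each
    determining which continuations lead into the language, give an automaton.
    This replaces transition functions by plain invariants of words. *)
Lemma regular_prefix_class (Q : finType) (f : seq A -> Q) K :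
  (forall u v w, f u = f v -> K (u ++ w) -> K (v ++ w)) -> regular K.
Proof.
move=> fK; pose rep q := xget [::] [set u | f u = q].
have repK u : f (rep (f u)) = f u by exact: (@xgetI _ [::] [set v | f v = f u] u).
have fKE u v w : f u = f v -> K (u ++ w) <-> K (v ++ w).
  by move=> fuv; split; apply: fK.
exists Q, (f [::]), (fun q x => f (rcons (rep q) x)), (fun q => `[< K (rep q) >]).
move=> w; rewrite unfold_in -{1}[w]cats0 -[rep _]cats0.
suff inv s : K (w ++ s) <->
    K (rep (foldl (fun q x => f (rcons (rep q) x)) (f [::]) w) ++ s).
  by split=> [/inv/asboolP|/asboolP/inv].
elim/last_ind: w s => [|w x IHw] s; first exact: fKE (esym (repK _)).
by rewrite cat_rcons IHw -cat_rcons foldl_rcons; apply: fKE (esym (repK _)).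
Qed.

(** The mirror image, for languages described by recursion on the head.  A prefix
    is classified by the set of suffix classes that complete it, so the number
    of prefix classes is finite too. *)
Lemma regular_suffix_class (Q : finType) (f : seq A -> Q) K :
  (forall x s t, f s = f t -> f (x :: s) = f (x :: t)) ->
  (forall s t, f s = f t -> K s -> K t) -> regular K.
Proof.
move=> f_cons fK; pose rep q := xget [::] [set u | f u = q].
have repK u : f u = f (rep (f u)).
  exact/esym/(@xgetI _ [::] [set v | f v = f u] u).
have f_cat w s t : f s = f t -> f (w ++ s) = f (w ++ t).
  by move=> fst; elim: w => //= x w /(f_cons x).
apply: (@regular_prefix_class _
  (fun u => [ffun q => `[< K (u ++ rep q) >]])) => u v w /ffunP/(_ (f w)).
rewrite !ffunE => uv /(fK _ _ (f_cat u _ _ (repK w)))/asboolP.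
by rewrite uv => /asboolP; apply: fK; apply: f_cat.
Qed.

Lemma regularI K1 K2 : regular K1 -> regular K2 -> regular (K1 `&` K2).
Proof.
move=> [Q1 [q1 [d1 [F1 K1E]]]] [Q2 [q2 [d2 [F2 K2E]]]].
apply: (@regular_prefix_class _ (fun u => (foldl d1 q1 u, foldl d2 q2 u))).
move=> u v w [uv1 uv2] [/K1E K1uw /K2E K2uw].
by split; [apply/K1E | apply/K2E]; rewrite foldl_cat -(uv1, uv2) -foldl_cat.
Qed.

Lemma regular_rcons K x : regular K -> regular [set rcons w x | w in K].
Proof.
move=> [Q [q0 [d [F KE]]]].
pose f u := (foldl d q0 u, `[< [set rcons w x | w in K] u >]).
apply: (@regular_prefix_class _ f).
move=> u v w [uvq uvK]; elim/last_ind: w => [|w y _].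
  by rewrite !cats0 => /asboolP; rewrite uvK => /asboolP.
rewrite -!rcons_cat => -[t Kt /rcons_inj[tuw <-]]; exists (v ++ w) => //.
by apply/KE; rewrite foldl_cat -uvq -foldl_cat -tuw; apply/KE.
Qed.

(** Pulls a regular language back along a partial relabelling of the letters; it
    transports languages over [A] to the padded pairs of letters. *)
Lemma regular_relabel (B : finType) (p : B -> option A) K :
  regular K -> regular [set z | exists2 w, K w & map p z = map Some w].
Proof.
move=> [Q [q0 [d [F KE]]]].
pose d' (q : option Q) b := if q is Some q then omap (d q) (p b) else None.
pose F' q := if q is Some q then q \in F else false.
exists (option Q), (Some q0), d', F'.
have dead z : foldl d' None z = None by elim: z.
have run q z : (exists2 w, foldl d q w \in F & map p z = map Some w) <->
    F' (foldl d' (Some q) z).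
  elim: z q => [|b z IHz] q /=; first by split=> [[[|x w] //]|qF]; exists [::].
  case: (p b) => [x|] /=; last by rewrite dead; split=> [[[|x w]]|].
  rewrite -IHz; split=> [[[//|y w] wF [-> zw]]|[w wF zw]]; first by exists w.
  by exists (x :: w); rewrite //= zw.
move=> z; rewrite -[_ \in F']/(F' _) -run.
by split=> -[w /KE]; exists w => //; apply/KE.
Qed.

End Regular.

Lemma eq_regular (A : finType) (K K' : language A) :
  (forall w, K w <-> K' w) -> regular K -> regular K'.
Proof. by move=> /predeqP ->. Qed.

(** Up to the first [b] of the second component both components agree, and from
    there on the second one repeats the first with a delay of one letter.  The
    state [Some (Some y)] stores the letter [y] that the second component still
    has to show; [None] is a sink. *)
Lemma regular_removal (B : finType) (b e : B) :
  regular [set z : seq (B * B) |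
    b \in unzip2 z /\ unzip1 z = rcons (rem b (unzip2 z)) e].
Proof.
pose d' (q : option (option B)) (xy : B * B) :=
  match q with
  | None => None
  | Some None => if xy.2 == b then Some (Some xy.1)
                 else if xy.1 == xy.2 then q else None
  | Some (Some y) => if xy.2 == y then Some (Some xy.1) else None
  end.
pose F' (q : option (option B)) := q == Some (Some e).
exists (option (option B)), (Some None), d', F'.
have dead z : foldl d' None z = None by elim: z.
have after x z :
    F' (foldl d' (Some (Some x)) z) = (x :: unzip1 z == rcons (unzip2 z) e).
  elim: z x => [|[x' y'] z IHz] x /=.
    by rewrite eqseq_cons eqxx andbT.
  rewrite eqseq_cons [y' == x]eq_sym.
  by case: eqP => _; [rewrite IHz | rewrite dead].
move=> z; rewrite -[_ \in F']/(F' _) /=.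
elim: z => [|[x y] z IHz] /=; first by split=> // -[].
have [-> /=|yb /=] := eqVneq y b.
  by rewrite after inE eqxx; split=> [[_ /eqP]|/eqP].
rewrite inE eq_sym (negPf yb) /=; case: eqP => [->|xy].
  by rewrite -IHz; split=> -[bz]; [case | ] => ->.
by rewrite dead; split=> // -[_ [/xy]].
Qed.

Section PaddedPairs.
Context {A : finType}.
Implicit Types (R : set (seq A * seq A)).

Lemma deltaR_succ (u v : seq A) : size v = (size u).+1 ->
  deltaR (u, v) = zip (rcons (map Some u) None) (map Some v).
Proof.
by move=> uv; rewrite /deltaR uv subSnn (eqP (leqnSn _)) cats0 cats1.
Qed.

Lemma deltaL_succ (u v : seq A) : size v = (size u).+1 ->
  deltaL (u, v) = zip (None :: map Some u) (map Some v).
Proof. by move=> uv; rewrite /deltaL uv subSnn (eqP (leqnSn _)). Qed.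

(** Left padding delays the first word by one position with respect to right
    padding.  The automaton stores the letter of the second word read last and
    feeds it to the given automaton together with the next letter of the first. *)
Lemma regular_deltaL R :
    (forall u v, R (u, v) -> size v = (size u).+1) ->
  regular (@deltaR A @` R) -> regular (@deltaL A @` R).
Proof.
move=> Rsize [Q [q0 [d [F KE]]]].
pose d' (q : option (option (Q * option A))) (xy : option A * option A) :=
  match q with
  | None => None
  | Some None => if xy.1 is None then Some (Some (q0, xy.2)) else None
  | Some (Some (q, y)) => Some (Some (d q (xy.1, y), xy.2))
  end.
exists (option (option (Q * option A))), (Some None), d'.
pose F' q := if q is Some (Some (q, y)) then d q (None, y) \in F else false.
exists F'.
have dead z : foldl d' None z = None by elim: z.
have run q y z : F' (foldl d' (Some (Some (q, y))) z) =
    (foldl d q (zip (rcons (unzip1 z) None) (y :: unzip2 z)) \in F).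
  elim: z q y => [|[x' y'] z IHz] q y //=; exact: IHz.
case=> [|[[x|] y] z]; rewrite -[_ \in F']/(F' _).
- by split=> // -[[u [|y v]] /Rsize uv]; rewrite deltaL_succ.
- rewrite [foldl _ _ _]dead; split=> // -[[u v] /Rsize uv].
  by rewrite deltaL_succ //; case: v uv.
rewrite [foldl _ _ _](_ : _ = foldl d' (Some (Some (q0, y))) z) // run -KE.
split=> -[[u v] Ruv]; have uv := Rsize _ _ Ruv.
  rewrite deltaL_succ //; case: v Ruv uv => // v0 v Ruv uv /= [<- <-].
  exists (u, v0 :: v) => //.
  rewrite deltaR_succ // unzip1_zip ?unzip2_zip // !size_map; move: uv => [->] //.
rewrite deltaR_succ // => zE; exists (u, v) => //; rewrite deltaL_succ //.
have /(congr1 (@unzip1 _ _)) := zE; have /(congr1 (@unzip2 _ _)) := zE.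
rewrite !unzip1_zip ?unzip2_zip /= ?size_rcons ?size_map ?uv //.
by move=> -> /rcons_inj[->]; rewrite /= zip_unzip.
Qed.

End PaddedPairs.

(** * The language as a pattern-avoiding class *)

Section Avoiding.
Context {n : nat}.
Implicit Types (a b c x y : 'I_n) (s t u v w : seq 'I_n).

Definition below c s := [seq x : 'I_n <- s | x < c].
Definition between a c s := has (fun b : 'I_n => a <= b < c) s.

Definition decr : rel 'I_n := fun x y => y < x.
(** Equivalently, no scattered subword [c a b] with [a <= b < c]. *)
Fixpoint avoids s :=
  if s is c :: t then sorted decr (below c t) && avoids t else true.

Lemma between_lt a c s : between a c s -> a < c.
Proof. by case/hasP => b _; lia. Qed.

Lemma decr_trans : transitive decr.
Proof. by rewrite /decr => y x z; lia. Qed.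

Lemma sorted_decr_subseq s t : subseq s t -> sorted decr t -> sorted decr s.
Proof. exact/subseq_sorted/decr_trans. Qed.

Lemma avoids_subseq s t : subseq s t -> avoids t -> avoids s.
Proof.
elim: t s => [|c t IHt] [|x s] //=; case: eqP => [->|_] st /andP[ct At].
  by rewrite (IHt s) // andbT (sorted_decr_subseq _ ct) // subseq_filterS.
exact: (IHt (x :: s)).
Qed.

Lemma avoids_after c w s : avoids (w ++ s) -> c \in w -> sorted decr (below c s).
Proof.
elim: w => //= x w IHw /andP[xs As]; rewrite inE => /predU1P[->|]; last exact: IHw.
by apply: sorted_decr_subseq xs; rewrite /below filter_cat suffix_subseq.
Qed.

(** Let [y] be the first letter of [s].  If the later letters below [y] do not
    decrease, the failure has moved on to [y].  If they do, the failure for [c]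
    can only come from a later [b] with [y <= b < c], and [c y] starts the
    factor. *)
Lemma not_sorted_factor c s : ~~ sorted decr (below c s) ->
  exists p (d x b : 'I_n) v q, x <= b < d /\
    c :: s = p ++ ([:: d; x] ++ v ++ [:: b]) ++ q.
Proof.
elim: s c => //= y s IHs c.
have [/IHs fac _ | /negbNE ys] := boolP (~~ sorted decr (below y s)).
  have [p [d [x [b [v [q [xbd ->]]]]]]] := fac.
  by exists (c :: p), d, x, b, v, q.
have [yc|cy] := ltnP y c; last first.
  case/negP; apply: sorted_decr_subseq ys.
  by apply: subseq_filterS => // z; lia.
have [/hasP[b bs ybc] _|/hasPn nsep] := boolP (between y c s).
  exists [::], c, y, b; case/splitPr: bs => v q.
  by exists v, q; rewrite /= -catA.
case/negP; rewrite /= path_sortedE; last exact: decr_trans.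
have eq_below : below c s = below y s.
  by apply: eq_in_filter => z /nsep; lia.
by rewrite eq_below ys andbT; apply: filter_all.
Qed.

Lemma sylvester_langE w : sylvester_lang w <-> avoids w.
Proof.
split=> [[_ nfac]|Aw].
  apply/negbNE/negP => nA; apply: nfac.
  suff [p [d [x [b [v [q [xbd ->]]]]]]] : exists p (d x b : 'I_n) v q, x <= b < d /\
      w = p ++ ([:: d; x] ++ v ++ [:: b]) ++ q.
    exists (p ++ ([:: d; x] ++ v ++ [:: b])); last by exists q; rewrite ?catA.
    exists p => //; exists ([:: d; x] ++ v ++ [:: b]) => //.
    by exists x, b, d, v.
  elim: w nA => //= c s IHs; rewrite negb_and => /orP[/not_sorted_factor //|].
  by move=> /IHs[p [d [x [b [v [q [xbd ->]]]]]]]; exists (c :: p), d, x, b, v, q.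
split=> // -[_ [p _ [_ [a [b [c [v [abc ->]]]]] <-]]] [q _ wE].
suff: avoids [:: c; a; b].
  by rewrite /= /decr; have [ac bc] : a < c /\ b < c by [lia]; rewrite ac bc /=; lia.
apply: avoids_subseq Aw; rewrite -wE -!catA.
apply: subseq_trans (suffix_subseq _ _); rewrite /= !eqxx.
by apply: subseq_trans (suffix_subseq _ _); rewrite /= eqxx sub0seq.
Qed.

End Avoiding.

(** * Search trees and uniqueness of normal forms *)

Section SearchTrees.
Context {n : nat}.
Implicit Types (a b c x y : 'I_n) (s t u v w : seq 'I_n).

Local Notation congr := (pres_congr (@sylvester_rules n)).

Inductive tree := Leaf | Node of tree & 'I_n & tree.
Implicit Types T : tree.

Fixpoint insert x T :=
  if T is Node l y r then
    if x <= y then Node (insert x l) y r else Node l y (insert x r)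
  else Node Leaf x Leaf.

Definition inserts u T := foldr insert T u.

Fixpoint postorder T :=
  if T is Node l y r then postorder l ++ postorder r ++ [:: y] else [::].

(** Whether the insertion paths of [a < c] separate at some node. *)
Fixpoint parts a c T :=
  if T is Node l y r then
    if c <= y then parts a c l else if y < a then parts a c r else true
  else false.

Lemma insertC a c T : a < c -> parts a c T ->
  insert c (insert a T) = insert a (insert c T).
Proof.
move=> ac; elim: T => //= l IHl y r IHr.
have [cy|yc] := leqP c y.
  by rewrite (leq_trans (ltnW ac) cy) /= cy (leq_trans (ltnW ac) cy) => /IHl ->.
have [ya|ay] := ltnP y a; first by rewrite /= leqNgt yc leqNgt ya /= => /IHr ->.
by rewrite /= leqNgt yc /= ay.
Qed.

Lemma parts_insert x a c T : parts a c T -> parts a c (insert x T).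
Proof.
elim: T => //= l IHl y r IHr; case: (leqP x y) => _ /=; do 2?case: ifP => // _; auto.
Qed.

Lemma parts_insert_between a b c T : a <= b < c -> parts a c (insert b T).
Proof.
move=> abc; elim: T => [|l IHl y r IHr] /=.
  have -> : (c <= b) = false by lia.
  by have -> : (b < a) = false by lia.
case: (leqP b y) => yb /=; case: ifP => // cy; [|by lia|].
  by case: ifP => // ya; lia.
by case: ifP.
Qed.

(** The invariant is stated for insertion into an arbitrary tree, which makes it
    compatible with concatenation. *)
Lemma congr_inserts u v :
  congr u v -> forall T, inserts u T = inserts v T.
Proof.
elim=> {u v} [l r [a [b [c [v [abc [-> ->]]]]]] | u | u v _ IH
  | u v w _ IHu _ IHv | u u' v v' _ IHu _ IHv] T //.
- rewrite /inserts /= insertC //; first by lia.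
  elim: v => [|x v IHv] /=; first exact: parts_insert_between.
  exact: parts_insert.
- by rewrite IHu IHv.
- by rewrite /inserts !foldr_cat -!/(inserts _ _) IHv IHu.
Qed.

Definition upto a s := [seq x : 'I_n <- s | x <= a].
Definition above a s := [seq x : 'I_n <- s | a < x].

Lemma inserts_Node u l b r :
  inserts u (Node l b r) = Node (inserts (upto b u) l) b (inserts (above b u) r).
Proof.
by rewrite /upto /above; elim: u => //= x u -> /=; case: leqP.
Qed.

(** A letter [y <= b] of [u] after a letter [x > b] would form the forbidden
    subword [x y b] with the last letter [b]. *)
Lemma avoids_last_split u b : avoids (rcons u b) -> u = upto b u ++ above b u.
Proof.
elim: u => //= x u IHu /andP[xu /IHu uE]; rewrite /upto /above /=.
case: leqP => xb /=; first by rewrite -/(above b u) -/(upto b u) -uE.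
rewrite -/(above b u) -/(upto b u).
suff u0 : upto b u = [::] by rewrite u0 {1}uE u0.
case E: (upto b u) => [//|y s].
have : y \in upto b u by rewrite E mem_head.
rewrite mem_filter => /andP[yb yu].
have : subseq [:: y; b] (rcons u b).
  by rewrite -cats1 -[[:: y; b]]/([:: y] ++ [:: b]) cat_subseq // sub1seq.
move/(subseq_filterS (fun (z : 'I_n) (h : z < x) => h))/sorted_decr_subseq/(_ xu).
by rewrite /= (leq_ltn_trans yb xb) xb /= /decr; lia.
Qed.

(** The last letter [b] is the root, and the letters before it are already split into
    those of its left and right subtrees. *)
Lemma postorder_inserts u : avoids u -> postorder (inserts u Leaf) = u.
Proof.
have [m] := ubnP (size u); elim: m u => // m IHm u.
case/lastP: u => [//|u b]; rewrite size_rcons ltnS => um Au.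
have Au' : avoids u by apply: avoids_subseq Au; apply: subseq_rcons.
rewrite /inserts -cats1 foldr_cat -/(inserts _ _) inserts_Node /=.
rewrite !IHm ?(leq_ltn_trans (size_subseq (filter_subseq _ _))) //.
- by rewrite catA -avoids_last_split.
- exact: avoids_subseq (filter_subseq _ _) Au'.
- exact: avoids_subseq (filter_subseq _ _) Au'.
Qed.

Lemma congr_avoids_eq u v :
  congr u v -> avoids u -> avoids v -> u = v.
Proof.
move=> /congr_inserts/(_ Leaf) uv /postorder_inserts <- /postorder_inserts <-.
by rewrite uv.
Qed.

Lemma congr_rcons_eq u v a : avoids u -> avoids v ->
  congr (rcons u a) v -> v = rcons (upto a u ++ above a u) a.
Proof.
move=> Au /postorder_inserts {2}<- /congr_inserts <-.
rewrite /inserts foldr_rcons -/(inserts _ _) inserts_Node /=.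
by rewrite !postorder_inserts ?(avoids_subseq (filter_subseq _ _) Au) // catA cats1.
Qed.

(** * Normal forms of products *)

(** The normal form of [a :: s] when [s] is a normal form: rules are applied to
    move [a] to the right as long as a later letter separates it from its right
    neighbour. *)
Fixpoint insert_word a s :=
  if s is x :: t then if between x a t then x :: insert_word a t else a :: s
  else [:: a].

(** Whether reversed rules can move the first [a] of [s] to the front. *)
Fixpoint extractable a s :=
  if s is x :: t then (x == a) || between x a t && extractable a t else false.

Lemma congr_cons x u v : congr u v ->
  congr (x :: u) (x :: v).
Proof. exact: (PresCat (PresRefl _ [:: x])). Qed.

Lemma congr_swap a c s : between a c s ->
  congr [:: c, a & s] [:: a, c & s].
Proof.
move=> /hasP[b bs abc]; case/splitPr: bs => v q.
have := PresCat (PresRule (R := @sylvester_rules n) (l := [:: c; a] ++ v ++ [:: b])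
  (r := [:: a; c] ++ v ++ [:: b]) _) (PresRefl _ q).
by rewrite /= -!catA; apply; exists a, b, c, v.
Qed.

Lemma extractable_mem a s : extractable a s -> a \in s.
Proof.
elim: s => //= x s IHs; rewrite inE eq_sym => /orP[->//|/andP[_ /IHs ->]].
by rewrite orbT.
Qed.

Lemma congr_extract a s : extractable a s ->
  congr (a :: rem a s) s.
Proof.
elim: s => //= x s IHs; have [-> _|xa /=] := eqVneq x a; first exact: PresRefl.
case/andP=> xas /IHs ars; apply: PresTrans (congr_cons x ars).
apply: congr_swap; case/hasP: xas => b bs xba; apply/hasP; exists b => //.
by rewrite rem_mem //; apply: contraTneq xba => ->; lia.
Qed.

Lemma mem_insert_word a s : insert_word a s =i a :: s.
Proof.
elim: s => //= x s IHs y; case: ifP => // _.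
by rewrite !inE IHs inE orbCA.
Qed.

Lemma extractable_insert a s : extractable a (insert_word a s).
Proof.
elim: s => [|x s IHs] /=; first by rewrite eqxx.
case: ifP => [xas|_] /=; last by rewrite eqxx.
apply/orP; right; rewrite IHs andbT; case/hasP: xas => b bs xba.
by apply/hasP; exists b => //; rewrite mem_insert_word inE bs orbT.
Qed.

Lemma rem_insert_word a s : rem a (insert_word a s) = s.
Proof.
elim: s => [|x s IHs] /=; first by rewrite eqxx.
case: ifP => [/between_lt xa|_] /=; last by rewrite eqxx.
by case: eqP => [xa'|_]; [move: xa; rewrite xa' ltnn | rewrite IHs].
Qed.

(** A letter [x] that [a] has passed is smaller than [a], so [a] creates no pattern
    starting with [x]; where [a] stops, no letter separates it from its
    neighbour, which bounds all the later letters below [a]. *)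
Lemma avoids_insert_word a s : avoids s -> avoids (insert_word a s).
Proof.
elim: s => //= x s IHs /andP[xs As]; case: ifP => [xas|/negbT/hasPn nxas] /=.
  rewrite IHs // andbT (_ : below x _ = below x s) // /below.
  have xa := between_lt xas.
  elim: s {IHs xs As xas} => [|y s IHs] /=; first by rewrite ltnNge ltnW.
  by case: ifP => _ /=; rewrite ?IHs // (ltnNge a) ltnW.
rewrite xs As !andbT /below /=; case: ifP => [xa|/negbT ax]; last first.
  by apply: sorted_decr_subseq xs; apply: subseq_filterS => // z; lia.
rewrite /= path_sortedE; last exact: decr_trans.
have eq_below : below a s = below x s.
  by apply: eq_in_filter => z /nxas; lia.
by rewrite -/(below a s) eq_below xs andbT; apply: filter_all.
Qed.

Lemma congr_consE a u v : avoids u -> avoids v ->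
  congr (a :: u) v <-> extractable a v /\ u = rem a v.
Proof.
move=> Au Av; split=> [auv|[/congr_extract + ->] //].
have vE : insert_word a u = v.
  apply: congr_avoids_eq (avoids_insert_word _ Au) Av.
  apply: PresTrans auv; apply: PresSym; rewrite -{1}[u](rem_insert_word a).
  exact: congr_extract (extractable_insert a u).
by rewrite -vE rem_insert_word; split; first exact: extractable_insert.
Qed.

(** Normal forms are reached by inserting the letters from the right end on. *)
Lemma avoids_representative u :
  exists2 v, avoids v & congr u v.
Proof.
elim: u => [|a u [v Av uv]]; first by exists [::]; last exact: PresRefl.
exists (insert_word a v); first exact: avoids_insert_word.
apply: PresTrans (congr_cons a uv) _; rewrite -{1}[v](rem_insert_word a).
exact: congr_extract (extractable_insert a v).
Qed.

(** The forward implication determines the normal form of [rcons u a]; its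
    existence gives the converse. *)
Lemma congr_rconsE u v a : avoids u -> avoids v ->
  congr (rcons u a) v <-> v = rcons (upto a u ++ above a u) a.
Proof.
move=> Au Av; split=> [|vE]; first exact: congr_rcons_eq.
have [v' Av' uav'] := avoids_representative (rcons u a).
by rewrite vE -(congr_rcons_eq Au Av' uav').
Qed.

Lemma avoids_rcons_split u a : avoids u -> avoids (rcons (upto a u ++ above a u) a).
Proof.
move=> Au; have [v Av uav] := avoids_representative (rcons u a).
by rewrite -(congr_rcons_eq Au Av uav).
Qed.

End SearchTrees.

(** * Regularity of the multiplication relations *)

Section SylvesterRegular.
Context {n : nat}.
Implicit Types (a b c x y : 'I_n) (s t u v w : seq 'I_n).

Lemma eq_letters s t : [set x in s]%SET = [set x in t]%SET -> s =i t.
Proof. by move=> /finset.setP st x; have := st x; rewrite !inE. Qed.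

Lemma letters_cons x s t : [set y in s]%SET = [set y in t]%SET ->
  [set y in x :: s]%SET = [set y in x :: t]%SET.
Proof. by move=> st; rewrite !set_cons st. Qed.

(** Prepending a letter needs only the set of the letters present and, for each
    [c], whether the letters below [c] decrease. *)
Lemma regular_avoids : regular [set s : seq 'I_n | avoids s].
Proof.
pose f s := ([set x in s]%SET, [ffun c => sorted decr (below c s)], avoids s).
apply: (@regular_suffix_class _ _ f) => [x s t|s t [_ _] /= -> //].
case=> st /ffunP dst Ast.
have {}dst c : sorted decr (below c s) = sorted decr (below c t).
  by have := dst c; rewrite !ffunE.
rewrite /f (letters_cons x st) /= dst Ast; congr (_, _, _).
apply/ffunP => c; rewrite !ffunE /below /=; case: ifP => xc /=; last exact: dst.
rewrite !path_sortedE; try exact: decr_trans.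
by rewrite -!/(below _ _) dst !all_filter (eq_all_r (eq_letters st)).
Qed.

Lemma regular_extractable a : regular [set s | extractable a s].
Proof.
apply: (@regular_suffix_class _ _ (fun s => ([set x in s]%SET, extractable a s)))
  => [x s t [st ast]|s t [_] /= -> //].
rewrite (letters_cons x st) /= ast; congr (_, _ || _ && _).
by rewrite /between (eq_has_r (eq_letters st)).
Qed.

Definition left_mul_pairs a : set (seq 'I_n * seq 'I_n) :=
  [set uv | [/\ avoids uv.2, extractable a uv.2 & uv.1 = rem a uv.2]].

Lemma left_mul_size a u v : left_mul_pairs a (u, v) -> size v = (size u).+1.
Proof.
by case=> /= _ /extractable_mem av ->; rewrite size_rem // prednK //; case: (v) av.
Qed.

Lemma regular_left_mul a : regular (@deltaR _ @` left_mul_pairs a).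
Proof.
have R := regular_relabel (fun xy : option 'I_n * option 'I_n => xy.2)
  (regularI regular_avoids (regular_extractable a)).
apply: eq_regular (regularI R (regular_removal (Some a) None)) => z.
split=> [[[v [Av av] zv] /= [_ z1]]|[[u v] uv <-]].
  have z2 : unzip2 z = map Some v by rewrite -zv.
  have uv : left_mul_pairs a (rem a v, v) by [].
  exists (rem a v, v) => //; rewrite (deltaR_succ (left_mul_size uv)).
  by rewrite -[RHS]zip_unzip z1 z2 rem_map_inj //; exact: Some_inj.
rewrite (deltaR_succ (left_mul_size uv)); case: (uv) => /= Av av uE.
have szv : size (rcons (map Some u) None) = size (map Some v).
  by rewrite size_rcons !size_map (left_mul_size uv).
split; first by exists v => //; rewrite -/(unzip2 _) unzip2_zip ?szv.
rewrite /= unzip1_zip ?szv // unzip2_zip ?szv //.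
by rewrite map_f ?extractable_mem // uE rem_map_inj //; exact: Some_inj.
Qed.

Lemma upto_upto a s : upto a (upto a s) = upto a s.
Proof. exact: filter_id. Qed.

Lemma above_upto a s : above a (upto a s) = [::].
Proof.
rewrite /above /upto -filter_predI -[RHS](filter_pred0 s).
by apply: eq_filter => x /=; lia.
Qed.

Lemma upto_above a s : upto a (above a s) = [::].
Proof.
rewrite /above /upto -filter_predI -[RHS](filter_pred0 s).
by apply: eq_filter => x /=; lia.
Qed.

Lemma above_above a s : above a (above a s) = above a s.
Proof. exact: filter_id. Qed.

Lemma upto_cat a s t : upto a (s ++ t) = upto a s ++ upto a t.
Proof. exact: filter_cat. Qed.

Lemma above_cat a s t : above a (s ++ t) = above a s ++ above a t.
Proof. exact: filter_cat. Qed.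

Lemma size_upto_above a s : size (upto a s) + size (above a s) = size s.
Proof.
rewrite /upto /above !size_filter -(count_predC (fun x : 'I_n => x <= a)).
by congr (_ + _); apply: eq_count => x /=; rewrite ltnNge.
Qed.

Lemma regular_split a : regular [set v | v = upto a v ++ above a v].
Proof.
pose f s := (upto a s == [::], s == upto a s ++ above a s).
apply: (@regular_suffix_class _ _ f) => [x s t [ust sst]|s t [_ st] /= /eqP].
  have fE r : f (x :: r) = if x <= a then (false, r == upto a r ++ above a r)
    else (upto a r == [::], upto a r == [::]).
    rewrite /f /upto /above /=; case: leqP => xa /=.
      by rewrite eqseq_cons eqxx.
    congr (_, _); case E: [seq y : 'I_n <- r | y <= a] => [|y r'].
      rewrite eqseq_cons !eqxx eq_sym; apply/eqP/all_filterP/allP => y yr.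
      rewrite ltnNge; apply: contra_eqN E => ya.
      by rewrite -has_filter; apply/hasP; exists y.
    have : y \in [seq y : 'I_n <- r | y <= a] by rewrite E mem_head.
    rewrite mem_filter eqseq_cons => /andP[ya _].
    rewrite [x == y](_ : _ = false) //; apply: contraTF xa => /eqP->.
    by rewrite -leqNgt.
  by rewrite !fE ust sst.
by rewrite st => /eqP.
Qed.

(** The relation of right multiplication by [a] with the final [a] removed: the
    two words have the same length, so no padding is involved. *)
Definition split_pairs a := [set z : seq ('I_n * 'I_n) |
  avoids (unzip1 z) /\ unzip2 z = upto a (unzip1 z) ++ above a (unzip1 z)].

(** Let [z] read [u1] in the first word and [v1] in the second, with [u2] the rest
    of the first.  Since [v1] is at least as long as [upto a u1], it has the form
    [upto a u1 ++ r] with [r] as long as [above a u1].  Either [r] is empty, or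
    [u1] has a letter above [a], and then [u2] has at most [n] letters up to [a]
    because they decrease strictly.  The lags [p] and [q] have the same length,
    the number of letters up to [a] in [r]. *)
Lemma split_pairs_lag a (z w : seq ('I_n * 'I_n)) :
  split_pairs a (z ++ w) -> exists p q,
  [/\ size p <= n, size q <= n,
      upto a (unzip2 z) = upto a (unzip1 z) ++ p
    & above a (unzip1 z) = above a (unzip2 z) ++ q].
Proof.
case; rewrite /unzip1 /unzip2 !map_cat -!/(unzip1 _) -!/(unzip2 _).
set u1 := unzip1 z; set u2 := unzip1 w; set v1 := unzip2 z; set v2 := unzip2 w.
rewrite upto_cat above_cat -catA => Au vE.
have u1v1 : size u1 = size v1 by rewrite !size_map.
have [|r v1E] := cat_eq_prefix _ (esym vE).
  by rewrite -u1v1 -(size_upto_above a u1) leq_addr.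
move=> rE.
have size_r : size r = size (above a u1).
  move: u1v1; rewrite v1E size_cat -(size_upto_above a u1); lia.
have := congr1 (above a) rE.
rewrite !above_cat !above_above above_upto cat0s => /esym/cat_eq_prefix[|q qE _].
  by rewrite -size_r -(size_upto_above a r) leq_addl.
have := congr1 (upto a) rE.
rewrite !upto_cat !upto_above upto_upto !cats0 => u2E.
have size_q : size q = size (upto a r).
  by move: size_r; rewrite qE size_cat -(size_upto_above a r); lia.
have size_p : size (upto a r) <= n.
  case u1E: (above a u1) size_r => [|c s].
    by rewrite -(size_upto_above a r); case: (size _).
  move=> _; have /andP[ac cu1] : (a < c) && (c \in u1).
    by rewrite -(mem_filter (fun x : 'I_n => a < x)) -/(above a u1) u1E mem_head.
  have u2_decr : sorted decr (upto a u2).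
    apply: sorted_decr_subseq (avoids_after Au cu1).
    by apply: subseq_filterS => // x xa; apply: leq_ltn_trans xa ac.
  have u2_uniq : uniq (upto a u2).
    by apply: sorted_uniq u2_decr => [|x]; [exact: decr_trans | exact: ltnn].
  rewrite (@leq_trans (size (upto a u2))) //; first by rewrite u2E size_cat leq_addr.
  by rewrite -(card_uniqP u2_uniq) (leq_trans (max_card _)) ?card_ord.
exists (upto a r), q; split; rewrite ?size_q //.
  by rewrite v1E upto_cat upto_upto.
by rewrite v1E above_cat above_upto.
Qed.

(** Two words are equal when both are split at [a] and agree on the letters up to
    [a] and on those above [a].  A prefix that can be completed is thus
    classified by the two bounded lags and by the states reached by its
    components in the automata for normal forms and for split words; all the
    other prefixes form one class. *)
Lemma regular_split_pairs a : regular (split_pairs a).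
Proof.
have [QA [qA [dA [FA avoidsE]]]] := regular_avoids.
have [QS [qS [dS [FS splitE]]]] := regular_split a.
pose alive z := exists w : seq ('I_n * 'I_n), split_pairs a (z ++ w).
pose lag1 (z : seq ('I_n * 'I_n)) :=
  drop (size (upto a (unzip1 z))) (upto a (unzip2 z)).
pose lag2 (z : seq ('I_n * 'I_n)) :=
  drop (size (above a (unzip2 z))) (above a (unzip1 z)).
pose f z := if `[< alive z >] then
  Some (foldl dA qA (unzip1 z), foldl dS qS (unzip2 z),
        insub_bseq n (lag1 z), insub_bseq n (lag2 z)) else None.
apply: (@regular_prefix_class _ _ f) => z z' w; rewrite /f.
case: asboolP => [aliveE|dead]; last by move=> _ Gzw; case: dead; exists w.
case: asboolP => // -[w' Gzw'] [AE SE l1E l2E] Gzw.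
have [p [q [pn qn pE qE]]] := split_pairs_lag Gzw.
have [p' [q' [pn' qn' pE' qE']]] := split_pairs_lag Gzw'.
have {l1E} pp' : p = p'.
  by move: (congr1 val l1E); rewrite /lag1 pE pE' !drop_size_cat // !insubdK.
have {l2E} qq' : q = q'.
  by move: (congr1 val l2E); rewrite /lag2 qE qE' !drop_size_cat // !insubdK.
case: Gzw => Azw vE; split.
  apply/avoidsE; rewrite /unzip1 map_cat foldl_cat -[foldl dA qA _]AE.
  rewrite -foldl_cat -map_cat.
  exact/avoidsE.
have vE' : unzip2 (z ++ w) = upto a (unzip2 (z ++ w)) ++ above a (unzip2 (z ++ w)).
  by rewrite vE upto_cat above_cat upto_upto upto_above above_upto above_above cats0.
have: unzip2 (z' ++ w) = upto a (unzip2 (z' ++ w)) ++ above a (unzip2 (z' ++ w)).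
  apply/splitE; rewrite /unzip2 map_cat foldl_cat -[foldl dS qS _]SE.
  rewrite -foldl_cat -map_cat.
  exact/splitE.
move=> ->; congr (_ ++ _).
  have : upto a (unzip2 (z ++ w)) = upto a (unzip1 (z ++ w)).
    by rewrite vE upto_cat upto_upto upto_above cats0.
  rewrite /unzip1 /unzip2 !map_cat !upto_cat -!/(unzip1 _) -!/(unzip2 _).
  by rewrite pE pE' -!catA => /eqP; rewrite eqseq_cat // eqxx -pp' => /eqP ->.
have : above a (unzip2 (z ++ w)) = above a (unzip1 (z ++ w)).
  by rewrite vE above_cat above_upto above_above.
rewrite /unzip1 /unzip2 !map_cat !above_cat -!/(unzip1 _) -!/(unzip2 _).
by rewrite qE qE' -!catA => /eqP; rewrite eqseq_cat // eqxx -qq' => /eqP ->.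
Qed.

Definition right_mul_pairs a : set (seq 'I_n * seq 'I_n) :=
  [set uv | avoids uv.1 /\ uv.2 = rcons (upto a uv.1 ++ above a uv.1) a].

Lemma right_mul_size a u v : right_mul_pairs a (u, v) -> size v = (size u).+1.
Proof. by case=> /= _ ->; rewrite size_rcons size_cat size_upto_above. Qed.

Lemma regular_right_mul a : regular (@deltaR _ @` right_mul_pairs a).
Proof.
pose p (xy : option 'I_n * option 'I_n) :=
  if xy is (Some x, Some y) then Some (x, y) else None.
have size_split u : size (upto a u ++ above a u) = size u.
  by rewrite size_cat size_upto_above.
have R := regular_rcons (None, Some a) (regular_relabel p (regular_split_pairs a)).
apply: eq_regular R => z; split=> [[z' [w [Aw wE] z'E] <-]|[[u v] uv <-]].
  have uv : right_mul_pairs a (unzip1 w, rcons (unzip2 w) a) by rewrite wE.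
  exists (unzip1 w, rcons (unzip2 w) a) => //.
  rewrite (deltaR_succ (right_mul_size uv)) map_rcons zip_rcons ?size_map //.
  congr (rcons _ _).
  elim: w z' z'E {Aw wE uv} => [|[x y] w IHw] [|[[x'|] [y'|]] z'] //=.
  by case=> -> -> /IHw <-.
rewrite (deltaR_succ (right_mul_size uv)); case: uv => /= Au ->.
rewrite map_rcons zip_rcons ?size_map ?size_split //.
eexists; last by [].
exists (zip u (upto a u ++ above a u)).
  by rewrite /split_pairs /= unzip1_zip ?unzip2_zip ?size_split.
move: (upto a u ++ _) (size_split u) => {}v.
by elim: u v {Au} => [|x u IHu] [|y v] //= [/IHu ->].
Qed.

Definition diagonal_pairs : set (seq 'I_n * seq 'I_n) :=
  [set uv | avoids uv.1 /\ uv.1 = uv.2].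

Lemma regular_diagonal : regular (@deltaR _ @` diagonal_pairs).
Proof.
pose p (xy : option 'I_n * option 'I_n) := if xy.1 == xy.2 then xy.1 else None.
have diag (u : seq 'I_n) : deltaR (u, u) = zip (map Some u) (map Some u).
  by rewrite /deltaR subnn cats0.
apply: eq_regular (regular_relabel p regular_avoids) => z.
split=> [[u Au zE]|[[u v] [Au uv] <-]].
  exists (u, u) => //; rewrite diag.
  elim: u z zE {Au} => [|x u IHu] [|[x' y'] z] //= [].
  by rewrite {1}/p /=; case: eqP => // <- -> /IHu ->.
exists u; first exact: Au.
by rewrite -(uv : u = v) diag; elim: u {Au uv} => //= x u ->; rewrite /p eqxx.
Qed.

Lemma deltaL_diagonal : @deltaL _ @` diagonal_pairs = @deltaR _ @` diagonal_pairs.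
Proof.
have diag (u : seq 'I_n) : deltaL (u, u) = deltaR (u, u).
  by rewrite /deltaL /deltaR subnn !cats0.
apply/predeqP => z; split=> -[[u v] [Au uv] <-]; exists (u, v) => //;
  by rewrite -(uv : u = v) diag.
Qed.

Lemma word_val_sylvester u v :
  word_val (@sylvester_gen n) u = word_val (@sylvester_gen n) v <->
  pres_congr (@sylvester_rules n) u v.
Proof. by rewrite !word_val_pres_gen; apply: pres_classP. Qed.

Lemma mulr_rel_sylvester a :
  mulr_rel (@sylvester_gen n) (@sylvester_lang n) (Some a) = right_mul_pairs a.
Proof.
apply/predeqP => -[u v].
split=> [[/= /sylvester_langE Au /sylvester_langE Av]|[/= Au ->]].
  by rewrite word_val_sylvester cats1 => /(congr_rconsE a Au Av).
have Aua := avoids_rcons_split a Au.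
split=> /=; rewrite ?sylvester_langE // word_val_sylvester cats1.
exact/(congr_rconsE a Au Aua).
Qed.

Lemma mull_rel_sylvester a :
  mull_rel (@sylvester_gen n) (@sylvester_lang n) (Some a) = left_mul_pairs a.
Proof.
apply/predeqP => -[u v].
split=> [[/= /sylvester_langE Au /sylvester_langE Av]|[/= Av av ->]].
  by rewrite word_val_sylvester => /(congr_consE a Au Av)[].
have Aav : avoids (rem a v) by apply: avoids_subseq Av; apply: rem_subseq.
split=> /=; rewrite ?sylvester_langE // word_val_sylvester.
exact/(congr_consE a Aav Av).
Qed.

Lemma mulr_rel_sylvester_empty :
  mulr_rel (@sylvester_gen n) (@sylvester_lang n) None = diagonal_pairs.
Proof.
apply/predeqP => -[u v]; rewrite /mulr_rel /= cats0; split=> [[Lu Lv]|[/= Au <-]].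
  rewrite word_val_sylvester => uv; split; first exact/sylvester_langE.
  by apply: congr_avoids_eq uv _ _; apply/sylvester_langE.
by split=> //; apply/sylvester_langE.
Qed.

Lemma mull_rel_sylvester_empty :
  mull_rel (@sylvester_gen n) (@sylvester_lang n) None = diagonal_pairs.
Proof.
rewrite -mulr_rel_sylvester_empty.
by apply/predeqP => -[u v]; rewrite /mulr_rel /= cats0.
Qed.

End SylvesterRegular.

Theorem theorem5p8 (n : nat) (hn : (1 <= n)%N) :
  biautomatic_structure (@sylvester_gen n) (@sylvester_lang n).
Proof.
split.
- by apply: eq_regular regular_avoids => w; rewrite sylvester_langE.
- move=> m; have [v /sylvester_langE Lv uv] := avoids_representative (repr m).
  exists v => //; rewrite word_val_pres_gen -[RHS]pres_class_repr.
  by apply/pres_classP; apply: PresSym.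
case=> [a|].
  rewrite mulr_rel_sylvester mull_rel_sylvester.
  split; [exact: regular_right_mul | exact: regular_left_mul | |].
    exact: regular_deltaL (@right_mul_size _ a) (regular_right_mul a).
  exact: regular_deltaL (@left_mul_size _ a) (regular_left_mul a).
rewrite mulr_rel_sylvester_empty mull_rel_sylvester_empty deltaL_diagonal.
by split; apply: regular_diagonal.
Qed.
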